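(* Let $V$ and $\widetilde V$ be finite-dimensional real inner product spaces, let $A\colon V\to V$ be symmetric positive semidefinite with $A\neq 0$, let $\Pi\colon\widetilde V\to V$ be a surjective linear operator, let $\widetilde B\colon\widetilde V\to\widetilde V$ be a linear operator, and set $\widetilde A=\Pi^tA\Pi$ and $B=\Pi\widetilde B\Pi^t$. Let $\widetilde W$ be a subspace of $\widetilde V$ with $\widetilde W\supset\mathcal R(\widetilde A)$ and let $\widetilde Q\colon\widetilde V\to\widetilde W$ be the orthogonal projection onto $\widetilde W$. If the operator $\widetilde B_{\widetilde Q}=\widetilde Q\widetilde B\widetilde Q^t\colon\widetilde W\to\widetilde W$ is SPD, then $$\lambda_{\min}(BA)=\left(\sup_{v\in\mathcal R(A),\ |v|_A=1}\ \inf_{\phi\in\mathcal N(A)}\ \inf_{\tilde v\in\widetilde W,\ \Pi\tilde v=v+\phi}(\widetilde B_{\widetilde Q}^{-1}\tilde v,\tilde v)\right)^{-1},$$ $$\lambda_{\max}(BA)=\left(\inf_{v\in\mathcal R(A),\ |v|_A=1}\ \inf_{\phi\in\mathcal N(A)}\ \inf_{\tilde v\in\widetilde W,\ \Pi\tilde v=v+\phi}(\widetilde B_{\widetilde Q}^{-1}\tilde v,\tilde v)\right)^{-1}.$$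
   Context: All inner products are denoted $(\cdot,\cdot)$; $T^t$ is the adjoint, $\mathcal N(T)$ the null space, $\mathcal R(T)$ the range of a linear operator $T$. $\widetilde Q^t\colon\widetilde W\to\widetilde V$ is the natural embedding. A symmetric operator $T$ is SPD if $(Tv,v)>0$ for all $v\ne0$, and symmetric positive semidefinite if $(Tv,v)\ge 0$ for all $v$; then $|v|_T=(Tv,v)^{1/2}$. Here $\lambda_{\min}(BA)$ denotes the smallest nonzero eigenvalue of $BA$ and $\lambda_{\max}(BA)$ the largest eigenvalue of $BA$. The infimum over an empty set is $+\infty$. *)

(* Defs.v *)
From HB Require Import structures.
From mathcomp Require Import all_boot all_order all_algebra.
From mathcomp Require Import all_classical all_reals.

Set Implicit Arguments.
Unset Strict Implicit.
Unset Printing Implicit Defensive.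

Import Order.TTheory GRing.Theory Num.Theory.

Local Open Scope ring_scope.
Local Open Scope classical_set_scope.

(* A real inner product on U is a term of type {dot U for idfun}: bilinear,
   symmetric and positive definite. *)

Section Restriction.
Context {R : numFieldType} {U : vectType R}.
Variables (ip : {dot U for (@idfun R)}) (W : {vspace U}).

Definition restr_dot (u v : subvs_of W) : R := ip (vsval u) (vsval v).

Fact restr_dot_bilinear : bilinear_for *%R (idfun \; *%R) restr_dot.
Proof.
split=> u a x y; first by rewrite /restr_dot linearP linearPl.
by rewrite /restr_dot [vsval (_ + _)]linearP linearPr.
Qed.
HB.instance Definition _ :=
  bilinear_isBilinear.Build R _ _ _ _ _ restr_dot restr_dot_bilinear.

Fact restr_dotC u v : restr_dot u v = (-1) ^+ false * idfun (restr_dot v u).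
Proof. exact: hermC. Qed.
HB.instance Definition _ :=
  isHermitianSesquilinear.Build R _ false idfun restr_dot restr_dotC.

Fact restr_dot_gt0 u : u != 0 -> 0 < restr_dot u u.
Proof. by move=> u0; apply: neq0_dnorm_gt0. Qed.
HB.instance Definition _ :=
  isDotProduct.Build R _ restr_dot restr_dot_gt0.
End Restriction.
Arguments restr_dot {R U} ip W u v.

Section Adjoint.
Context {R : numFieldType} {U V : vectType R}.
Variables (ipU : {dot U for (@idfun R)}) (ipV : {dot V for (@idfun R)}).

Definition is_adjoint (T : 'Hom(U, V)) (S : 'Hom(V, U)) : Prop :=
  forall u v, ipV (T u) v = ipU u (S v).

(* [adjointP] and [adjoint_uniq] below: this is the adjoint of T *)
Definition adjoint (T : 'Hom(U, V)) : 'Hom(V, U) :=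
  xget 0 [set S | is_adjoint T S].

Lemma riesz (f : 'Hom(U, R^o)) : exists w, forall u, f u = ipU u w.
Proof.
pose g (w : U) : 'Hom(U, R^o) := linfun (applyr ipU w : U -> R^o).
have gE w u : g w u = ipU u w by rewrite lfunE.
have glin : linear g.
  move=> a x y; apply/lfunP => u.
  by rewrite gE add_lfunE scale_lfunE !gE linearPr.
pose Gl : {linear U -> 'Hom(U, R^o)} :=
  HB.pack g (GRing.isLinear.Build _ _ _ _ g glin).
pose G : 'Hom(U, 'Hom(U, R^o)) := linfun Gl.
have Ginj : lker G == 0%VS.
  apply/lker0P => x y; rewrite !lfunE /= => Gxy.
  apply/eqP; rewrite -subr_eq0; apply/negPn/negP => /(@neq0_dnorm_gt0 _ _ _ ipU).
  by rewrite linearBr /= -!gE Gxy subrr ltxx.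
have Gsurj : limg G = fullv.
  apply/eqP; rewrite eqEdim subvf /= limg_dim_eq.
    by rewrite !dimvf /dim /= muln1.
  by rewrite (eqP Ginj) capv0.
have /memv_imgP[w _ fw] : f \in limg G by rewrite Gsurj memvf.
by exists w => u; rewrite fw lfunE /= gE.
Qed.

Lemma adjointP (T : 'Hom(U, V)) : is_adjoint T (adjoint T).
Proof.
rewrite /adjoint; case: xgetP => [S _ //|noS]; exfalso.
have /choice[s sP] (v : V) : exists w, forall u, ipV (T u) v = ipU u w.
  have [w wP] := riesz (linfun (applyr ipV v : V -> R^o) \o T)%VF.
  by exists w => u; rewrite -wP comp_lfunE lfunE.
have slin : linear s.
  move=> a x y; apply/eqP; rewrite -subr_eq0; apply/negPn/negP.
  set d := (X in X != 0) => /(@neq0_dnorm_gt0 _ _ _ ipU).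
  by rewrite {2}/d linearBr linearPr /= -!sP linearPr subrr ltxx.
pose S : {linear V -> U} := HB.pack s (GRing.isLinear.Build _ _ _ _ s slin).
by apply: (noS (linfun S)) => u v; rewrite lfunE /= sP.
Qed.

Lemma adjoint_uniq (T : 'Hom(U, V)) S : is_adjoint T S -> S = adjoint T.
Proof.
move=> TS; apply/lfunP => v; apply/eqP; rewrite -subr_eq0; apply/negPn/negP.
set d := (X in X != 0) => /(@neq0_dnorm_gt0 _ _ _ ipU).
by rewrite {2}/d linearBr /= -TS adjointP subrr ltxx.
Qed.
End Adjoint.

Section OrthogonalProjection.
Context {R : numFieldType} {U : vectType R}.
Variables (ip : {dot U for (@idfun R)}) (W : {vspace U}).

(* projection onto W along its orthogonal complement, with codomain W *)
Definition oproj : 'Hom(U, subvs_of W) :=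
  (linfun (vsproj W) \o daddv_pi W (orthov ip W))%VF.

Lemma capv_orthov : (W :&: orthov ip W = 0)%VS.
Proof.
apply/eqP; rewrite -subv0; apply/subvP => w; rewrite memv_cap => /andP[wW].
move=> /mem_orthovP/(_ _ wW) ww; rewrite memv0; apply/negPn/negP.
by move=> /(@neq0_dnorm_gt0 _ _ _ ip); rewrite ww ltxx.
Qed.

Lemma addv_orthov : (W + orthov ip W = fullv)%VS.
Proof.
apply/vspaceP => u; rewrite memvf.
pose E : 'Hom(subvs_of W, U) := linfun vsval.
pose q := adjoint (restr_dot ip W) ip E u.
have qP (w : subvs_of W) : ip (vsval w) u = ip (vsval w) (vsval q).
  by have := adjointP (restr_dot ip W) ip E w u; rewrite lfunE.
rewrite -[u](subrK (vsval q)) addrC memv_add ?subvsP //.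
apply/mem_orthovP => w wW.
by rewrite hermC mul1r /= linearBr /= -(vsprojK wW) qP subrr.
Qed.

Lemma oprojP u (w : subvs_of W) : ip (u - vsval (oproj u)) (vsval w) = 0.
Proof.
have := daddv_pi_add capv_orthov; move=> /(_ u); rewrite addv_orthov memvf.
rewrite /oproj comp_lfunE lfunE /= vsprojK ?memv_pi // => /(_ isT) uE.
rewrite -{1}uE addrC addKr.
by have /mem_orthovP->// := memv_pi (orthov ip W) W u; exact: subvsP.
Qed.

Lemma adjoint_oproj : adjoint ip (restr_dot ip W) oproj = linfun vsval.
Proof.
apply/esym/adjoint_uniq => u w; rewrite [linfun _ w]lfunE /=.
by have /eqP := oprojP u w; rewrite linearBl /= subr_eq0 => /eqP->.
Qed.
End OrthogonalProjection.

Section Operators.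
Context {R : realType} {U : vectType R}.
Variable ip : {dot U for (@idfun R)}.

Definition symmetric_op (T : 'End(U)) : Prop :=
  forall u v, ip (T u) v = ip u (T v).
Definition spd (T : 'End(U)) : Prop :=
  symmetric_op T /\ forall v, v != 0 -> 0 < ip (T v) v.
Definition psd (T : 'End(U)) : Prop :=
  symmetric_op T /\ forall v, 0 <= ip (T v) v.
Definition energy_norm (T : 'End(U)) (v : U) : R := Num.sqrt (ip (T v) v).
End Operators.

Section Eigenvalues.
Context {R : realType} {U : vectType R}.

Definition is_lambda_min (T : 'End(U)) (l : R) : Prop :=
  [/\ passmx.leigenvalue T l, l != 0 &
      forall m, passmx.leigenvalue T m -> m != 0 -> l <= m].
Definition is_lambda_max (T : 'End(U)) (l : R) : Prop :=
  passmx.leigenvalue T l /\ forall m, passmx.leigenvalue T m -> m <= l.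
End Eigenvalues.

(* Main.v *)
(* Put P = Pi|tW, C = tB_tQ and K = A P C P^t A. Since R(tA) is contained in tW,
   A Pi = A P tQ, so K = A B A, and the nonzero eigenvalues of BA are those of
   the pencil K u = l A u on R(A), where both A and K are SPD; the extreme ones
   are the extrema of the Rayleigh quotient (Ku, u) / (Au, u). On the other
   side, Cauchy-Schwarz for the form of C bounds (C^-1 w, w) below by
   (Av, v)^2 / (Kv, v) for every w admissible for v, and w = C P^t A z, with z
   in R(A) solving K z = A v, has energy (Av, z). *)
Require Import Defs.
From mathcomp Require Import all_boot all_order all_algebra.
From mathcomp Require Import all_classical all_reals ereal.
From mathcomp Require Import ring lra.

Set Implicit Arguments.
Unset Strict Implicit.
Unset Printing Implicit Defensive.

Import Order.TTheory GRing.Theory Num.Theory.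

Local Open Scope ring_scope.
Local Open Scope classical_set_scope.

(** * Cauchy-Schwarz and extremal Rayleigh quotients for symmetric operators *)

Section Dot.
Context {R : realType} {U : vectType R}.
Variable ip : {dot U for (@idfun R)}.

Lemma dotC u v : ip u v = ip v u.
Proof. by rewrite hermC expr0 mul1r. Qed.

Lemma dotDl u v w : ip (u + v) w = ip u w + ip v w.
Proof. exact: linearDl. Qed.

Lemma dotDr u v w : ip u (v + w) = ip u v + ip u w.
Proof. exact: linearD. Qed.

Lemma dotZl a u v : ip (a *: u) v = a * ip u v.
Proof. exact: linearZl_LR. Qed.

Lemma dotZr a u v : ip u (a *: v) = a * ip u v.
Proof. exact: linearZ. Qed.

Lemma dot0l u : ip 0 u = 0.
Proof. exact: linear0l. Qed.

Lemma dot_suml I (s : seq I) (F : I -> U) v :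
  ip (\sum_(i <- s) F i) v = \sum_(i <- s) ip (F i) v.
Proof. by rewrite dotC linear_sum; apply: eq_bigr => i _; exact: dotC. Qed.

Lemma dot_gt0 u : u != 0 -> 0 < ip u u.
Proof. exact: neq0_dnorm_gt0. Qed.

Lemma dot_eq0 u : ip u u = 0 -> u = 0.
Proof. by move=> uu; apply/eqP/negPn/negP => /dot_gt0; rewrite uu ltxx. Qed.

Lemma psd_id : psd ip \1%VF.
Proof.
split=> [u v|v]; rewrite !id_lfunE //.
by have [->|/dot_gt0/ltW//] := eqVneq v 0; rewrite dot0l.
Qed.

(** The form at [a *: x + b *: y] is a nonnegative quadratic form in [(a, b)]; suitable values of
    [a] and [b] give the inequality, even if [T] is degenerate. *)
Lemma psd_cauchy (T : 'End(U)) : psd ip T ->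
  forall x y, ip (T x) y ^+ 2 <= ip (T x) x * ip (T y) y.
Proof.
move=> [Ts Tp] x y; have Tyx : ip (T y) x = ip (T x) y by rewrite Ts dotC.
have disc a b : 0 <= a ^+ 2 * ip (T x) x + 2 * a * b * ip (T x) y
                     + b ^+ 2 * ip (T y) y.
  apply: le_trans (Tp (a *: x + b *: y)) _.
  have -> : T (a *: x + b *: y) = a *: T x + b *: T y by rewrite linearD !linearZ.
  by rewrite dotDl !dotDr !dotZl !dotZr Tyx; lra.
have := Tp x; have := Tp y.
move: (ip (T x) x) (ip (T x) y) (ip (T y) y) disc {Tyx} => a m b disc b0 a0.
have [b_eq0|b_neq0] := eqVneq b 0.
  have [->|m_neq0] := eqVneq m 0; first by rewrite b_eq0 expr0n mulr0.
  (* Here the form is affine in its second argument; this value makes it [- a - 2 < 0], a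
     contradiction. *)
  have := disc 1 (- (a + 1) / m).
  have -> : 2 * 1 * (- (a + 1) / m) * m = - 2 * (a + 1) by field.
  rewrite b_eq0 !mulr0; lra.
have bgt0 : 0 < b by rewrite lt_def b_neq0.
have := disc b (- m).
have -> : b ^+ 2 * a + 2 * b * - m * m + (- m) ^+ 2 * b = b * (a * b - m ^+ 2) by ring.
by rewrite pmulr_rge0 // subr_ge0.
Qed.

Lemma spd_psd (T : 'End(U)) : spd ip T -> psd ip T.
Proof.
move=> [Ts Tp]; split=> // v; have [->|/Tp/ltW//] := eqVneq v 0.
by rewrite linear0.
Qed.

Lemma spd_lker0 (T : 'End(U)) : spd ip T -> lker T == 0%VS.
Proof.
move=> [_ Tp]; rewrite -subv0; apply/subvP => v; rewrite memv_ker memv0 => /eqP Tv.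
by apply/negPn/negP => /Tp; rewrite Tv dot0l ltxx.
Qed.

(** Cauchy-Schwarz at [x] and [T x] bounds the square of [ip (T x) (T x)] by zero. *)
Lemma psd_ker (T : 'End(U)) x : psd ip T -> ip (T x) x = 0 -> T x = 0.
Proof.
move=> Tpsd Tx; apply: dot_eq0.
have := psd_cauchy Tpsd x (T x); rewrite Tx mul0r => h.
by apply/eqP; rewrite -sqrf_eq0 eq_le h sqr_ge0.
Qed.

Lemma psd_lker0_spd (T : 'End(U)) : psd ip T -> lker T == 0%VS -> spd ip T.
Proof.
move=> Tpsd /lker0P Tinj; have [Ts Tp] := Tpsd; split=> // v v0.
rewrite lt_def Tp andbT; apply: contraNneq v0 => /(psd_ker Tpsd) Tv.
by rewrite -(inj_eq Tinj) Tv linear0.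
Qed.

Lemma spd_invf (T : 'End(U)) : spd ip T -> spd ip T^-1%VF.
Proof.
move=> Tspd; have TK := lker0_lfunVK (spd_lker0 Tspd); have [Ts Tp] := Tspd.
split=> [u v|v v0]; first by rewrite -{2}[u]TK -{1}[v]TK Ts.
rewrite dotC -{1}[v]TK; apply: Tp; apply: contraNneq v0 => Tv.
by rewrite -[v]TK Tv linear0.
Qed.

Lemma spd_inv_cauchy (T : 'End(U)) : spd ip T ->
  forall x y, ip x y ^+ 2 <= ip (T^-1%VF x) x * ip (T y) y.
Proof.
move=> Tspd x y; have := psd_cauchy (spd_psd Tspd) (T^-1%VF x) y.
by rewrite lker0_lfunVK ?spd_lker0 // [ip x (_ x)]dotC.
Qed.

Lemma dot_inj u v : (forall w, ip u w = ip v w) -> u = v.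
Proof.
move=> uv; apply/eqP; rewrite -subr_eq0; apply/eqP/dot_eq0.
by rewrite dotDl uv -dotDl subrr dot0l.
Qed.

(** Expand [x] in a basis. By Riesz each coordinate is an inner product with some [r i], so each
    summand is a product of two inner products with [x], bounded by Cauchy-Schwarz and
    [2ab <= a^2 + b^2]. *)
Lemma op_form_bounded (S : 'End(U)) :
  exists2 M, 0 < M & forall x, ip (S x) x <= M * ip x x.
Proof.
pose e := vbasis (fullv : {vspace U}).
have /choice[r rP] (i : 'I_(\dim (fullv : {vspace U}))) :
    exists w, forall u, coord e i u = ip u w.
  have [w wP] := riesz ip (linfun (coord e i : U -> R^o)).
  by exists w => u; rewrite -wP lfunE.
pose c i := ip (r i) (r i) + ip (S e`_i) (S e`_i).
have ip0 v : 0 <= ip v v by have [_ /(_ v)] := psd_id; rewrite id_lfunE.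
(* The 1 only makes the constant strictly positive. *)
exists (1 + \sum_i c i) => [|x].
  by rewrite ltr_pwDl // sumr_ge0 // => i _; rewrite addr_ge0.
rewrite mulrDl mul1r -[X in X <= _]add0r lerD //.
rewrite {1}(coord_vbasis (memvf x)) [S _]linear_sum dot_suml mulr_suml.
apply: ler_sum => i _; rewrite linearZ /= dotZl rP.
have cs u v : ip u v ^+ 2 <= ip u u * ip v v.
  by have := psd_cauchy psd_id u v; rewrite !id_lfunE.
have := cs x (r i); have := cs (S e`_i) x; rewrite /c.
by have := sqr_ge0 (ip x (r i) - ip (S e`_i) x); nra.
Qed.

(* The supremum [l] of the Rayleigh quotient is an eigenvalue: otherwise
   [l H - K] is injective, hence at least [eps H], and [l - eps] is still an
   upper bound. *)
Lemma rayleigh_max (H K : 'End(U)) : spd ip H -> symmetric_op ip K ->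
  (exists x : U, x != 0) ->
  exists l x, [/\ x != 0, K x = l *: H x &
    forall y, ip (K y) y <= l * ip (H y) y].
Proof.
move=> Hspd Ks [x0 x0_neq0]; have [Hs Hp] := Hspd.
(* Coercivity of [T]: the form of the inverse is bounded, and [(x,x)^2 <= (T^-1 x,x)(T x,x)]. *)
have ipH (T : 'End(U)) : spd ip T ->
    exists2 M, 0 < M & forall x, ip x x <= M * ip (T x) x.
  move=> Tspd; have [M M0 MP] := op_form_bounded T^-1%VF; exists M => // x.
  have [->|x_neq0] := eqVneq x 0; first by rewrite !linear0 mulr0.
  have xx := dot_gt0 x_neq0; rewrite -(ler_pM2l xx) -expr2.
  apply: le_trans (spd_inv_cauchy Tspd x x) _; rewrite mulrCA mulrA ler_wpM2r ?MP//.
  by have [_ ->] := spd_psd Tspd.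
pose q x := ip (K x) x / ip (H x) x.
pose E := [set q x | x in [set x : U | x != 0]].
have supE : has_sup E.
  split; first by exists (q x0); exists x0.
  have [M M0 MP] := op_form_bounded K; have [N N0 NP] := ipH _ Hspd.
  exists (M * N) => _ [x /= xn0 <-]; rewrite ler_pdivrMr ?Hp//.
  by apply: le_trans (MP x) _; rewrite -mulrA ler_wpM2l // ltW.
set l := sup E.
have lP y : ip (K y) y <= l * ip (H y) y.
  have [->|yn0] := eqVneq y 0; first by rewrite !linear0 mulr0.
  by rewrite -ler_pdivrMr ?Hp//; apply: sup_upper_bound => //; exists y.
pose T : 'End(U) := l *: H - K.
have TE x : T x = l *: H x - K x by rewrite add_lfunE opp_lfunE scale_lfunE.
have TipE x y : ip (T x) y = l * ip (H x) y - ip (K x) y.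
  by rewrite TE -scaleN1r dotDl !dotZl mulN1r.
have Tpsd : psd ip T.
  split=> [u v|v]; last by rewrite TipE subr_ge0.
  by rewrite TipE Hs Ks dotC -![ip u (_ v)]dotC -TipE dotC.
have [/(psd_lker0_spd Tpsd) Tspd|] := boolP (lker T == 0%VS); last first.
  rewrite -subv0 => /subvPn[x]; rewrite memv_ker memv0 => /eqP Tx xn0.
  by exists l, x; split=> //; apply/esym/eqP; rewrite -subr_eq0 -TE Tx.
have [M M0 MP] := op_form_bounded H; have [N N0 NP] := ipH _ Tspd.
have MN0 : 0 < M * N by rewrite mulr_gt0.
(* [eps] is [(M * N)^-1] because [(Hx,x) <= M (x,x) <= M N (Tx,x)]. *)
suff : l <= l - (M * N)^-1.
  by rewrite -subr_ge0 addrAC subrr add0r oppr_ge0 leNgt invr_gt0 MN0.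
apply: ge_sup => [|_ [x /= xn0 <-]]; first by have [] := supE.
rewrite ler_pdivrMr ?Hp// mulrBl lerBrDr -lerBrDl mulrC ler_pdivrMr// -TipE.
rewrite mulrC -mulrA; apply: le_trans (MP x) _.
by rewrite ler_wpM2l // ltW.
Qed.

End Dot.

(** * Operators that are SPD on a subspace *)

Section SpdOn.
Context {R : realType} {U : vectType R}.
Variables (ip : {dot U for (@idfun R)}) (W : {vspace U}).

(** [T] may be degenerate on [U]; the range condition makes its restriction an endomorphism of [W],
    to which the results on SPD operators apply. *)
Definition spd_on (T : 'End(U)) : Prop :=
  [/\ (limg T <= W)%VS, symmetric_op ip T &
      forall v, v \in W -> v != 0 -> 0 < ip (T v) v].

Definition restr_op (T : 'End(U)) : 'End(subvs_of W) :=
  (linfun (vsproj W) \o T \o linfun vsval)%VF.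

Lemma restr_opE (T : 'End(U)) (w : subvs_of W) :
  (limg T <= W)%VS -> vsval (restr_op T w) = T (vsval w).
Proof.
move=> /subvP TW; rewrite !comp_lfunE !lfunE /= vsprojK //.
by apply: TW; rewrite memv_img ?memvf.
Qed.

Lemma restr_dotE (u v : subvs_of W) :
  (restr_dot ip W : {dot subvs_of W for (@idfun R)}) u v =
  ip (vsval u) (vsval v).
Proof. by []. Qed.

Lemma restr_op_spd T : spd_on T -> spd (restr_dot ip W) (restr_op T).
Proof.
move=> [TW Ts Tp]; split=> [u v|v v0].
  by rewrite !restr_dotE !restr_opE.
rewrite restr_dotE restr_opE //; apply: Tp; first exact: subvsP.
by apply: contraNneq v0 => v0; apply/eqP/val_inj.
Qed.

(** Positivity makes the restriction injective, hence invertible in finite dimension. *)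
Lemma spd_on_surj T y : spd_on T -> y \in W -> exists2 z, z \in W & T z = y.
Proof.
move=> Ton yW; have [TW _ _] := Ton.
have TK := lker0_lfunVK (spd_lker0 (restr_op_spd Ton)).
exists (vsval ((restr_op T)^-1%VF (vsproj W y))); first exact: subvsP.
by rewrite -restr_opE // TK vsprojK.
Qed.

Lemma spd_on_normalize H x : spd_on H -> x \in W -> x != 0 ->
  exists c, ip (H (c *: x)) (c *: x) = 1.
Proof.
move=> [_ _ Hp] xW x0; have Hx := Hp x xW x0.
exists (Num.sqrt (ip (H x) x))^-1.
rewrite [H _]linearZ dotZl dotZr mulrA -expr2 exprVn sqr_sqrtr ?ltW//.
by rewrite mulVf // gt_eqF.
Qed.

Lemma rayleigh_max_on H K : spd_on H -> spd_on K -> W != 0%VS ->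
  exists l x, [/\ 0 < l, x \in W, x != 0, K x = l *: H x &
    forall y, y \in W -> ip (K y) y <= l * ip (H y) y].
Proof.
move=> Hon Kon W0; have [HW _ Hp] := Hon; have [KW _ Kp] := Kon.
have [//|l [x [x0 Kx lP]]] :=
  rayleigh_max (restr_op_spd Hon) (proj1 (restr_op_spd Kon)).
  exists (vsproj W (vpick W)); apply: contraNneq W0 => pick0.
  by rewrite -vpick0 -(vsprojK (memv_pick W)) pick0.
have {}x0 : vsval x != 0 by apply: contraNneq x0 => x0; apply/eqP/val_inj.
have {}Kx : K (vsval x) = l *: H (vsval x) by rewrite -!restr_opE // Kx linearZ.
have xW : vsval x \in W := subvsP x.
exists l, (vsval x); split=> // [|y yW].
  by have := Kp _ xW x0; rewrite Kx dotZl pmulr_lgt0 ?Hp.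
by have := lP (vsproj W y); rewrite !restr_dotE !restr_opE // vsprojK.
Qed.

End SpdOn.

(** The range meets the kernel trivially: [A (A z) = 0] gives [(Az,Az) = (z,A(Az)) = 0]. *)
Lemma spd_on_limg (R : realType) (V : vectType R) (ip : {dot V for (@idfun R)})
  (A : 'End(V)) : psd ip A -> spd_on ip (limg A) A.
Proof.
move=> Apsd; have [As Ap] := Apsd; split=> // v /memv_imgP[z _ ->] v0.
rewrite lt_def Ap andbT; apply: contraNneq v0 => /(psd_ker Apsd) AAz.
by apply/eqP/(@dot_eq0 _ _ ip); rewrite As AAz linear0.
Qed.

Lemma leigenvalueP (R : realType) (V : vectType R) (T : 'End(V)) (m : R) :
  reflect (exists2 x, x != 0 & T x = m *: x) (passmx.leigenvalue T m).
Proof.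
have kerE x : (x \in passmx.leigenspace T m) = (T x == m *: x).
  by rewrite memv_ker add_lfunE opp_lfunE scale_lfunE id_lfunE subr_eq0.
apply: (iffP idP) => [|[x x0 Tx]].
  rewrite /passmx.leigenvalue -subv0 => /subvPn[x].
  by rewrite kerE memv0 => /eqP Tx x0; exists x.
by apply: contraNneq x0 => T0; rewrite -memv0 -T0 kerE Tx.
Qed.

Lemma oproj_id (R : realType) (U : vectType R) (ip : {dot U for (@idfun R)})
  (W : {vspace U}) u : u \in W -> vsval (oproj ip W u) = u.
Proof.
move=> uW; apply/eqP; rewrite eq_sym -subr_eq0; apply/eqP/(@dot_eq0 _ _ ip).
have dW : u - vsval (oproj ip W u) \in W by rewrite memvB ?subvsP.
by rewrite -{2}(vsprojK dW) oprojP.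
Qed.

(** * Energy bounds for an SPD operator on an auxiliary space *)

Section FictitiousSpace.
Context {R : realType} {V W : vectType R}.
Variables (ip : {dot V for (@idfun R)}) (ipW : {dot W for (@idfun R)}).
Variables (A : 'End(V)) (P : 'Hom(W, V)) (Pt : 'Hom(V, W)) (C : 'End(W)).
Hypotheses (Apsd : psd ip A) (PtP : is_adjoint ipW ip P Pt) (Cspd : spd ipW C).
Hypothesis Ptinj : forall x, Pt (A x) = 0 -> A x = 0.

Let K : 'End(V) := (A \o P \o C \o Pt \o A)%VF.

Let KE x : K x = A (P (C (Pt (A x)))).
Proof. by rewrite !comp_lfunE. Qed.

Lemma precond_form x y : ip (K x) y = ipW (C (Pt (A x))) (Pt (A y)).
Proof. by rewrite KE (proj1 Apsd) PtP. Qed.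

(** [(Kv,v)] is the form of [C] at [Pt (A v)], which [Ptinj] keeps nonzero for nonzero [v] in the
    range of [A]. *)
Lemma precond_spd_on : spd_on ip (limg A) K.
Proof.
have [Cs Cp] := Cspd; split=> [|u v|v vA v0].
- apply/subvP => _ /memv_imgP[x _ ->].
  by rewrite KE memv_img ?memvf.
- by rewrite precond_form Cs dotC -precond_form dotC.
- rewrite precond_form; apply: Cp; apply: contraNneq v0 => /Ptinj Av0.
  have [_ _ Ap] := spd_on_limg Apsd.
  by apply/negPn/negP => /(Ap _ vA); rewrite Av0 dot0l ltxx.
Qed.

(** Since [A phi = 0], [(Av,v) = (Av,Pw) = (w,Pt(Av))]; Cauchy-Schwarz for the pair [C^-1], [C]
    concludes. *)
Lemma energy_lower_bound v phi w : A phi = 0 -> P w = v + phi ->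
  ip (A v) v ^+ 2 <= ipW (C^-1%VF w) w * ip (K v) v.
Proof.
move=> Aphi Pw; have -> : ip (A v) v = ipW w (Pt (A v)).
  rewrite -PtP Pw dotDl -[ip phi _](proj1 Apsd) Aphi dot0l addr0.
  by rewrite dotC.
by rewrite precond_form; apply: spd_inv_cauchy.
Qed.

Lemma energy_attained v z : K z = A v ->
  exists2 w, A (P w) = A v & ipW (C^-1%VF w) w = ip (A v) z.
Proof.
move=> Kz; exists (C (Pt (A z))); first by rewrite -KE.
by rewrite lker0_lfunK ?(spd_lker0 Cspd) // dotC -precond_form Kz.
Qed.

End FictitiousSpace.

Theorem theorem5p4 (R : realType) (V tV : vectType R)
  (ipV : {dot V for (@idfun R)}) (iptV : {dot tV for (@idfun R)})
  (A : 'End(V)) (A_psd : psd ipV A) (A_neq0 : A != 0)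
  (Pi : 'Hom(tV, V)) (Pi_surj : limg Pi = fullv)
  (tB : 'End(tV)) (tW : {vspace tV}) :
  let Pit := adjoint iptV ipV Pi in
  let tA : 'End(tV) := (Pit \o A \o Pi)%VF in
  let B : 'End(V) := (Pi \o tB \o Pit)%VF in
  let iptW := restr_dot iptV tW in
  let tQ := oproj iptV tW in
  let tQt := adjoint iptV iptW tQ in
  let tBQ : 'End(subvs_of tW) := (tQ \o tB \o tQt)%VF in
  let S : set V := [set v | v \in limg A /\ energy_norm ipV A v = 1] in
  let J (v : V) : \bar R :=
    ereal_inf [set ereal_inf
        [set (iptW ((tBQ^-1)%VF w) w)%:E
          | w in [set w : subvs_of tW | Pi (vsval w) = v + phi]]
      | phi in [set phi : V | phi \in lker A]] in
  (limg tA <= tW)%VS ->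
  spd iptW tBQ ->
  exists lmin lmax : R,
    [/\ is_lambda_min (B \o A)%VF lmin,
        lmin%:E = ((ereal_sup [set J v | v in S])^-1)%E,
        is_lambda_max (B \o A)%VF lmax
      & lmax%:E = ((ereal_inf [set J v | v in S])^-1)%E].
Proof.

(* Transfer from [tV] to the subspace [tW] *)
move=> Pit tA B iptW tQ tQt C S J tAW Cspd.
have [As Ap] := A_psd.
have PitP u v : ipV (Pi u) v = iptV u (Pit v) by exact: adjointP.
have tQtE (w : subvs_of tW) : tQt w = vsval w.
  by rewrite /tQt adjoint_oproj lfunE.
pose ipW : {dot subvs_of tW for (@idfun R)} := restr_dot iptV tW.
have tQP u (w : subvs_of tW) : ipW (tQ u) w = iptV u (vsval w).
  by rewrite -tQtE; exact: (adjointP iptV ipW tQ u w).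
pose P : 'Hom(subvs_of tW, V) := (Pi \o linfun vsval)%VF.
have PE (w : subvs_of tW) : P w = Pi (vsval w) by rewrite comp_lfunE lfunE.
pose Pt : 'Hom(V, subvs_of tW) := (tQ \o Pit)%VF.
have PtP : is_adjoint ipW ipV P Pt.
  move=> w v; rewrite PE PitP [RHS]dotC comp_lfunE tQP; exact: dotC.
(* By surjectivity [x = Pi u], so [Pit (A x) = tA u] lies in [tW] and the projection fixes it. *)
have PitA x : vsval (Pt (A x)) = Pit (A x).
  rewrite comp_lfunE oproj_id //.
  have /memv_imgP[u _ ->] : x \in limg Pi by rewrite Pi_surj memvf.
  apply: (subvP tAW); have -> : Pit (A (Pi u)) = tA u by rewrite !comp_lfunE.
  by rewrite memv_img ?memvf.
have Ptinj x : Pt (A x) = 0 -> A x = 0.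
  move=> Ax0; have /memv_imgP[u _ Axu] : A x \in limg Pi by rewrite Pi_surj memvf.
  by apply: (@dot_eq0 _ _ ipV); rewrite {1}Axu PitP -PitA Ax0 linear0.
(* Dual of [PitA], obtained by pairing with an arbitrary [y]. *)
have APi t : A (Pi t) = A (P (tQ t)).
  apply: (@dot_inj _ _ ipV) => y.
  by rewrite !As PitP PtP tQP; congr (iptV t _); exact/esym/PitA.
pose K : 'End(V) := (A \o P \o C \o Pt \o A)%VF.
have BE x : B x = Pi (tB (Pit x)) by rewrite !comp_lfunE.
have KE x : K x = A (B (A x)).
  by rewrite BE -PitA -tQtE APi !comp_lfunE.
have limgA0 : limg A != 0%VS.
  apply: contraNneq A_neq0 => A0; apply/eqP/lfunP => x.
  by apply/eqP; rewrite zero_lfunE -memv0 -A0 memv_img ?memvf.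
have Aon := spd_on_limg A_psd.
have Kon : spd_on ipV (limg A) K := precond_spd_on A_psd PtP Cspd Ptinj.
have [lmax [x [lmax0 xA x0 Kx lmaxP]]] := rayleigh_max_on Aon Kon limgA0.
(* With [K] and [A] exchanged, the maximum [m] is the reciprocal of the least quotient of [K]
   relative to [A]. *)
have [m [z [m0 zA z0 Az mP]]] := rayleigh_max_on Kon Aon limgA0.
(* The eigenvector is [B (A y)], not [y]: the pencil equation holds only after applying [A]. *)
have eig l y : A y != 0 -> K y = l *: A y -> l != 0 ->
    passmx.leigenvalue (B \o A)%VF l.
  move=> Ay Ky l0; apply/leigenvalueP; exists (B (A y)).
    apply: contraNneq Ay => BAy; move: Ky; rewrite KE BAy linear0 => /esym/eqP.
    by rewrite scaler_eq0 (negPf l0).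
  by rewrite comp_lfunE -KE Ky linearZ.
(* An eigenvector [y] need not lie in the range of [A]; it is replaced by the [u] there with
   [A u = A y]. *)
have eigP l : passmx.leigenvalue (B \o A)%VF l -> l != 0 ->
    exists u, [/\ u \in limg A, 0 < ipV (A u) u & ipV (K u) u = l * ipV (A u) u].
  move=> /leigenvalueP[y y0]; rewrite comp_lfunE => BAy l0.
  have [u uA Au] := spd_on_surj Aon (memv_img A (memvf y)).
  have Ay : A y != 0.
    apply: contraNneq y0 => Ay; move: BAy; rewrite Ay linear0 => /esym/eqP.
    by rewrite scaler_eq0 (negPf l0).
  exists u; split=> //; last by rewrite KE Au BAy linearZ dotZl.
  have [_ _] := Aon; apply=> //; apply: contraNneq Ay => u0.
  by rewrite -Au u0 linear0.

(* Two-sided bounds on the inner infimum [J] *)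
have energy1 v : energy_norm ipV A v = 1 <-> ipV (A v) v = 1.
  split=> [h|h]; last by rewrite /energy_norm h sqrtr1.
  by rewrite -[LHS]sqr_sqrtr ?Ap // [Num.sqrt _]h expr1n.
have J_ge v k : ipV (A v) v = 1 -> 0 < k -> ipV (K v) v <= k ->
    (k^-1%:E <= J v)%E.
  move=> Av k0 Kv; apply: le_ereal_inf_tmp => _ [phi /= phiA <-].
  apply: le_ereal_inf_tmp => _ [w /= Pw <-].
  rewrite lee_fin -[k^-1]mul1r ler_pdivrMr //.
  have Aphi : A phi = 0 by apply/eqP; rewrite -memv_ker.
  have := energy_lower_bound A_psd PtP Cspd Aphi (etrans (PE w) Pw).
  rewrite Av expr1n => h; apply: le_trans h _.
  rewrite ler_wpM2l //.
  by have [_] := spd_psd (spd_invf Cspd); apply.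
have J_le v y : K y = A v -> (J v <= (ipV (A v) y)%:E)%E.
  move=> Ky; have [w APw wE] := energy_attained A_psd PtP Cspd Ky.
  rewrite -wE; apply: ge_ereal_inf; eexists.
    (* Attainment gives only [A (P w) = A v]; the kernel component [phi] absorbs the difference. *)
    exists (P w - v) => //=.
    by rewrite memv_ker linearB /= APw subrr.
  apply: ge_ereal_inf; exists (ipW ((C^-1)%VF w) w)%:E => //.
  by exists w => //=; rewrite -PE addrC subrK.
have normalize u l : u \in limg A -> u != 0 -> K u = l *: A u ->
    exists v, [/\ S v, ipV (A v) v = 1 & K v = l *: A v].
  move=> uA u0 Ku; have [c cu1] := spd_on_normalize Aon uA u0.
  exists (c *: u); split=> //; first by split; [exact: memvZ | exact/energy1].
  by rewrite [K _]linearZ [A _]linearZ /= Ku !scalerA mulrC.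
have A_neq u : u \in limg A -> u != 0 -> A u != 0.
  have [_ _ Apos] := Aon => uA u0.
  by apply: contraTneq (Apos u uA u0) => ->; rewrite dot0l ltxx.
have Kz : K z = m^-1 *: A z by rewrite Az scalerA mulVf ?scale1r ?gt_eqF.
have lmax_neq0 : lmax != 0 by rewrite gt_eqF.
have mV_neq0 : m^-1 != 0 by rewrite invr_neq0 ?gt_eqF.

(* The two extreme eigenvalues *)
exists m^-1, lmax; split.
- split=> //; first exact: eig (A_neq z zA z0) Kz mV_neq0.
  move=> l /eigP/[apply] -[u [uA Au Ku]].
  rewrite -[m^-1]mul1r ler_pdivrMr // -(ler_pM2r Au) mul1r.
  by apply: le_trans (mP u uA) _; rewrite Ku; lra.
- suff -> : ereal_sup [set J v | v in S] = m%:E.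
    by rewrite inver gt_eqF.
  apply/eqP; rewrite eq_le; apply/andP; split.
    apply: ge_ereal_sup => _ [v [vA /energy1 Av] <-].
    have [y yA Ky] := spd_on_surj Kon (memv_img A (memvf v)).
    apply: le_trans (J_le v y Ky) _; rewrite lee_fin.
    (* With [t = (Av,y)]: [t^2 <= (Ay,y) <= m (Ky,y) = m t], hence [t <= m]. *)
    have := psd_cauchy A_psd v y; rewrite Av mul1r => h1.
    have := mP y yA; rewrite Ky => h2.
    have h3 := le_trans h1 h2.
    have [/le_trans-> //|t0] := leP (ipV (A v) y) 0; first exact: ltW.
    by rewrite -(ler_pM2r t0) -expr2.
  have [v [vS Av Kv]] := normalize z _ zA z0 Kz.
  apply: le_ereal_sup_tmp; exists (J v); first by exists v.
  rewrite -[m]invrK; apply: J_ge => //; first by rewrite invr_gt0.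
  by rewrite Kv dotZl Av mulr1.
- split; first exact: eig (A_neq x xA x0) Kx lmax_neq0.
  (* Zero may be an eigenvalue of [BA]; it is below the positive [lmax]. *)
  move=> l lE; have [->|l0] := eqVneq l 0; first exact: ltW.
  have [u [uA Au Ku]] := eigP l lE l0.
  by rewrite -(ler_pM2r Au) -Ku; exact: lmaxP.
- suff -> : ereal_inf [set J v | v in S] = lmax^-1%:E.
    by rewrite inver invr_eq0 (negPf lmax_neq0) invrK.
  apply/eqP; rewrite eq_le; apply/andP; split; last first.
    apply: le_ereal_inf_tmp => _ [v [vA /energy1 Av] <-].
    by apply: J_ge => //; have := lmaxP v vA; rewrite Av mulr1.
  have [v [vS Av Kv]] := normalize x _ xA x0 Kx.
  apply: ge_ereal_inf; exists (J v); first by exists v.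
  (* At the maximizer, [lmax^-1 *: v] solves [K y = A v]. *)
  have -> : lmax^-1 = ipV (A v) (lmax^-1 *: v) by rewrite dotZr Av mulr1.
  by apply: J_le; rewrite linearZ /= Kv scalerA mulVf // scale1r.
Qed.
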